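(* Let $\mathbf B$ denote either $\mathbf B_\pm$ or $\mathbf B_\varepsilon$. Then for every $x=(x_1,x_2,x_3)\in\Omega$, $$ \mathbf B(x)=\begin{cases}1,&\text{if } x_3+x_2\ge0,\\[4pt] 1-\dfrac{(x_3+x_2)^2}{x_2^2-x_1^2},&\text{if } x_3+x_2<0.\end{cases} $$
   Context: Let $I=[0,1]$, $\mathcal D(I)$ its dyadic subintervals, and $h_J$ the Haar function equal to $|J|^{-1/2}$ on the right half of $J$, $-|J|^{-1/2}$ on the left half, $0$ off $J$. $\langle f\rangle_I=\frac1{|I|}\int_I f$. Let $\Omega=\{(x_1,x_2,x_3)\in\mathbb R^3:|x_1|\le x_3\}$. For $x\in\Omega$ consider pairs of functions on $I$: $\varphi=x_1+\sum_{J\in\mathcal D(I)}(\varphi,h_J)h_J$, $\psi=x_2+\sum_{J\in\mathcal D(I)}\varepsilon_J(\varphi,h_J)h_J$ (the sums having a finite, unspecified number of terms), with $\langle|\varphi|\rangle_I=x_3$. $\mathfrak A_\pm(x)$ is the set of such pairs with all $\varepsilon_J=\pm1$; $\mathfrak A_\varepsilon(x)$ is the set of such pairs with all $|\varepsilon_J|\le1$. Define $\mathbf B_\pm(x)=\sup_{\mathfrak A_\pm(x)}\frac1{|I|}|\{t\in I:\psi(t)\ge0\}|$ and $\mathbf B_\varepsilon(x)=\sup_{\mathfrak A_\varepsilon(x)}\frac1{|I|}|\{t\in I:\psi(t)\ge0\}|$. *)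

(* Defs.v *)
From HB Require Import structures.
From mathcomp Require Import all_boot all_order all_algebra.
From mathcomp Require Import finmap.
From mathcomp Require Import all_classical all_reals all_analysis.
Set Implicit Arguments.
Unset Strict Implicit.
Unset Printing Implicit Defensive.
Import Order.TTheory GRing.Theory Num.Theory.
Local Open Scope classical_set_scope.
Local Open Scope ring_scope.

Definition unitI (R : realType) : set R := `[0, 1]%classic.
Arguments unitI R : clear implicits.

Definition lenI (R : realType) : R :=
  fine (@lebesgue_measure R (unitI R)).

Definition mean (R : realType) (f : R -> R) : R :=
  (lenI R)^-1 * Rintegral (@lebesgue_measure R) (unitI R) f.

(* The index (n, k) with k < 2^n stands for [k/2^n, (k+1)/2^n[; this is a
   bijection with the dyadic subintervals of [0,1]. Intervals are half-open, so
   Haar functions are fixed at every point; another choice at the endpoints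
   changes finite sums only on finite sets, which have measure zero. *)
Definition dyadic : Type := {n : nat & 'I_(2 ^ n)}.
HB.instance Definition _ := Choice.on dyadic.

Definition dlen (R : realType) (J : dyadic) : R := (2 ^+ tag J)^-1.
Definition dleft (R : realType) (J : dyadic) : R :=
  (tagged J : nat)%:R * dlen R J.
Definition dmid (R : realType) (J : dyadic) : R := dleft R J + dlen R J / 2.
Definition dright (R : realType) (J : dyadic) : R := dleft R J + dlen R J.

Definition haar (R : realType) (J : dyadic) (t : R) : R :=
  if dmid R J <= t < dright R J then (Num.sqrt (dlen R J))^-1
  else if dleft R J <= t < dmid R J then - (Num.sqrt (dlen R J))^-1
  else 0.

Definition haar_coef (R : realType) (f : R -> R) (J : dyadic) : R :=
  Rintegral (@lebesgue_measure R) (unitI R) (fun t => f t * haar J t).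

(* Only the values of phi and psi on [0,1] matter. *)
Definition admissible (R : realType) (E : set R) (x1 x2 x3 : R)
    (phi psi : R -> R) : Prop :=
  exists (F : {fset dyadic}) (eps : dyadic -> R),
    [/\ forall J, J \in F -> E (eps J),
        forall t, unitI R t ->
          phi t = x1 + \sum_(J <- F) haar_coef phi J * haar J t,
        forall t, unitI R t ->
          psi t = x2 + \sum_(J <- F) eps J * haar_coef phi J * haar J t
      & mean (fun t => `|phi t|) = x3].

Definition A_pm (R : realType) (x1 x2 x3 : R) : (R -> R) -> (R -> R) -> Prop :=
  admissible [set e | e = 1 \/ e = -1] x1 x2 x3.

Definition A_eps (R : realType) (x1 x2 x3 : R) : (R -> R) -> (R -> R) -> Prop :=
  admissible [set e | `|e| <= 1] x1 x2 x3.

Definition nonneg_frac (R : realType) (psi : R -> R) : R :=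
  (lenI R)^-1 *
  fine (@lebesgue_measure R [set t | unitI R t /\ 0 <= psi t]).

(* The supremum is taken in the extended reals, where it is -oo on the empty
   family, so that no junk value is possible. *)
Definition B_pm (R : realType) (x1 x2 x3 : R) : \bar R :=
  ereal_sup [set y | exists phi psi : R -> R,
    A_pm x1 x2 x3 phi psi /\ y = (nonneg_frac psi)%:E].

Definition B_eps (R : realType) (x1 x2 x3 : R) : \bar R :=
  ereal_sup [set y | exists phi psi : R -> R,
    A_eps x1 x2 x3 phi psi /\ y = (nonneg_frac psi)%:E].

(* Main.v *)
Require Import Defs.
From HB Require Import structures.
From mathcomp Require Import all_boot all_order all_algebra.
From mathcomp Require Import finmap.
From mathcomp Require Import all_classical all_reals all_analysis.
From mathcomp Require Import ring lra zify.
Set Implicit Arguments.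
Unset Strict Implicit.
Unset Printing Implicit Defensive.
Import Order.TTheory GRing.Theory Num.Theory.
Local Open Scope classical_set_scope.
Local Open Scope ring_scope.

(** Write x3 = <|phi|> and let bellman x1 x2 x3 be the claimed value.  A finite
    Haar expansion is a finite dyadic martingale: passing from an interval to
    its halves replaces the averages (x, y) of (phi, psi) by
    (x - d, y - e d) and (x + d, y + e d), where e is the multiplier, while the
    average of |phi| splits arbitrarily.  A pair (phi, psi) is therefore the
    same thing as a finite binary tree labelled by steps and signs
    (tree_of_admissible, admissible_of_tree), and the supremum becomes one over
    trees.

    The supremum is at most bellman.  On the cone |x| <= z the function bellman
    is midpoint concave along all directions (d, e d, s) with |e| <= 1
    (bellman_midconcave): below the plane z + y = 0 it equals
    1 - (z + y)^2 / (y^2 - x^2), and y^2 - x^2 is concave along such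
    directions, so the quotient, a square over a concave function, is convex.
    It also dominates the terminal value [0 <= y] at z = |x|.  Induction on the
    tree concludes (tree_nonneg_le_bellman).

    The supremum is at least bellman.  The supremum over trees is nonnegative,
    at least 1 where z = |x| and y >= 0, and midpoint concave along the
    directions (d, d, s) and (d, -d, s), because two trees can be grafted under
    a common root (biconcave_sup_tree).  Any function f with these properties
    dominates bellman (bellman_le_biconcave).  Being bounded below, f is concave
    on segments in these directions.  A direction whose backward ray stays in
    the cone lets f only decrease, since a point far behind contributes at
    least 0; two such moves from any point with z + y >= 0 reach
    (0, z + y, 0), where f >= 1.  In the region z + y < 0, bellman is linear on
    the segments joining a point (+- q, - q, q), where f >= 1, to a boundary point
    z = |x|; and on the boundary it is linear between the edge x = z = 0 and
    such a point.  Concavity of f on these segments gives the bound,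
    and only the signs 1 and -1 are used, which is why both families have the
    same supremum. *)

(** * Concavity of the explicit formula *)

Definition bellman (R : realType) (x y z : R) : R :=
  if 0 <= z + y then 1 else 1 - (z + y) ^+ 2 / (y ^+ 2 - x ^+ 2).

Lemma sqrB_gt0_cone (R : realType) (x y z : R) :
  `|x| <= z -> z + y < 0 -> 0 < y ^+ 2 - x ^+ 2.
Proof.
move=> hx hy; have := ler_norm x; have := ler_norm (- x); rewrite normrN.
by move=> ? ?; rewrite subr_sqr; nra.
Qed.

Lemma bellman_le1 (R : realType) (x y z : R) : `|x| <= z -> bellman x y z <= 1.
Proof.
move=> hx; rewrite /bellman; case: (leP 0 (z + y)) => //= hy.
by rewrite lerBlDr lerDl divr_ge0 ?sqr_ge0// ltW// (sqrB_gt0_cone hx).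
Qed.

Lemma bellman_ge_boundary (R : realType) (x y : R) : (0 <= y)%R%:R <= bellman x y `|x|.
Proof.
rewrite /bellman; case: (leP 0 (`|x| + y)) => /= hy.
  by rewrite lern1 leq_b1.
have -> : (0 <= y) = false by apply/negbTE; rewrite -ltNge; have := normr_ge0 x; lra.
have q0 := sqrB_gt0_cone (lexx _) hy.
rewrite /= subr_ge0 ler_pdivrMr// mul1r -(real_normK (num_real x)).
by have := normr_ge0 x; nra.
Qed.

(** The map (a, p) |-> a^2 / p is jointly convex and decreasing in p. *)
Lemma sqr_div_midconvex (R : realFieldType) (a b p q r : R) :
  0 < p -> 0 < q -> p + q <= 2 * r ->
  ((a + b) / 2) ^+ 2 / r <= (a ^+ 2 / p + b ^+ 2 / q) / 2.
Proof.
move=> p0 q0 h; have r0 : 0 < r by lra.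
rewrite ler_pdivrMr//.
(* With a = p u and b = q v the claim is Cauchy-Schwarz:
   (p u + q v)^2 <= (p + q) (p u^2 + q v^2). *)
have [u au] : exists u, a = p * u.
  by exists (a / p); rewrite mulrC divfK ?gt_eqF.
have [v bv] : exists v, b = q * v.
  by exists (b / q); rewrite mulrC divfK ?gt_eqF.
have -> : a ^+ 2 / p = p * u ^+ 2 by rewrite au; field; rewrite gt_eqF.
have -> : b ^+ 2 / q = q * v ^+ 2 by rewrite bv; field; rewrite gt_eqF.
rewrite au bv.
have S0 : 0 <= p * u ^+ 2 + q * v ^+ 2.
  by rewrite addr_ge0// mulr_ge0 ?sqr_ge0// ltW.
have := ler_wpM2l S0 h.
have : 0 <= p * q * (u - v) ^+ 2 by rewrite mulr_ge0 ?sqr_ge0// ltW// mulr_gt0.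
nra.
Qed.

(** The case of [bellman_midconcave] where the segment crosses the plane
    z + y = 0.  The half of the segment beyond the plane is cut off at the
    crossing point P: there z = - y, so the cone condition gives y^2 - x^2 >= 0,
    which may fail at the far endpoint itself. *)
Lemma bellman_midconcave_crossing (R : realType) (x y d e z1 z2 : R) :
  `|e| <= 1 -> `|x + d| <= z1 -> `|x - d| <= z2 ->
  z1 + (y + e * d) < 0 -> 0 <= z2 + (y - e * d) ->
  (z1 + (y + e * d)) + (z2 + (y - e * d)) < 0 ->
  ((z1 + z2) / 2 + y) ^+ 2 / (y ^+ 2 - x ^+ 2) <=
  (z1 + (y + e * d)) ^+ 2 / ((y + e * d) ^+ 2 - (x + d) ^+ 2) / 2.
Proof.
move=> he h1 h2 a0 b0 ab0.
have p0 := sqrB_gt0_cone h1 a0.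
set a := z1 + _ in a0 ab0 *; set b := z2 + _ in b0 ab0 *.
set p := _ - (x + d) ^+ 2 in p0 *.
have -> : (z1 + z2) / 2 + y = (a + b) / 2 by rewrite /a /b; field.
(* The midpoint is l times the near endpoint plus 1 - l times P. *)
set l := (a + b) / (2 * a).
have l0 : 0 < l by rewrite /l -mulrNN -invrN divr_gt0; lra.
have la : l * a = (a + b) / 2 by rewrite /l; field; rewrite lt_eqF.
have lp : l * p <= y ^+ 2 - x ^+ 2.
  (* P is m times the near endpoint plus 1 - m times the far one; s is its
     parameter when the endpoints have parameters 1 and -1. *)
  set m := b / (b - a).
  have ba : 0 < b - a by lra.
  have m0 : 0 <= m by rewrite divr_ge0// ltW.
  have m1 : m <= 1 by rewrite ler_pdivrMr//; lra.
  pose s := 2 * m - 1.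
  have ls : l + (1 - l) * s = 0.
    by rewrite /l /s /m; field; rewrite (lt_eqF a0) (gt_eqF ba).
  have l1 : l <= 1.
    rewrite leNgt; apply/negP => l1.
    have : l * a < a by rewrite gtr_nMl//.
    by rewrite la; lra.
  have P : 0 <= (y + s * e * d) ^+ 2 - (x + s * d) ^+ 2.
    have Pz : m * z1 + (1 - m) * z2 = - (y + s * e * d).
      have : m * a + (1 - m) * b = 0 by rewrite /m; field; rewrite gt_eqF.
      by rewrite /a /b /s; lra.
    have := ler_norm (x + d); have := ler_norm (- (x + d)).
    have := ler_norm (x - d); have := ler_norm (- (x - d)).
    rewrite !normrN => u1 u2 u3 u4.
    have Px1 : x + s * d <= - (y + s * e * d) by rewrite -Pz /s; nra.
    have Px2 : - (x + s * d) <= - (y + s * e * d) by rewrite -Pz /s; nra.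
    by rewrite subr_sqr; nra.
  have e2 : 0 <= 1 - e ^+ 2.
    by rewrite -(real_normK (num_real e)); have := normr_ge0 e; nra.
  have : y ^+ 2 - x ^+ 2 - l * p
     - (1 - l) * ((y + s * e * d) ^+ 2 - (x + s * d) ^+ 2)
     = (1 - e ^+ 2) * d ^+ 2 * (l + (1 - l) * s ^+ 2)
       - 2 * (e * d * y - d * x) * (l + (1 - l) * s).
    by rewrite /p; ring.
  rewrite ls mulr0 subr0 => E.
  have : 0 <= (1 - e ^+ 2) * d ^+ 2 * (l + (1 - l) * s ^+ 2).
    have := sqr_ge0 s; have := sqr_ge0 d => d2 s2.
    by apply: mulr_ge0; [exact: mulr_ge0|apply: addr_ge0; [exact: ltW|rewrite mulr_ge0 ?subr_ge0]].
  have : 0 <= (1 - l) * ((y + s * e * d) ^+ 2 - (x + s * d) ^+ 2).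
    by rewrite mulr_ge0// subr_ge0.
  by rewrite -E; lra.
apply: (@le_trans _ _ (((a + b) / 2) ^+ 2 / (l * p))).
  apply: ler_wpM2l; first exact: sqr_ge0.
  have lp0 : 0 < l * p by rewrite mulr_gt0.
  by rewrite lef_pV2 ?posrE// (lt_le_trans lp0 lp).
have -> : ((a + b) / 2) ^+ 2 / (l * p) = ((a + b) / 2) * a / p.
  by rewrite -la; field; rewrite !gt_eqF.
rewrite [leRHS]mulrAC ler_wpM2r ?invr_ge0 ?(ltW p0)//; nra.
Qed.

(** Writing w = z + y and q = y^2 - x^2, the function 1 - bellman is w^2 / q
    where w < 0 and 0 elsewhere; w is affine, and q is concave along the
    direction (d, e d) because its second-order term is (e^2 - 1) d^2. *)
Lemma bellman_midconcave (R : realType) (x y d e z1 z2 : R) :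
  `|e| <= 1 -> `|x - d| <= z1 -> `|x + d| <= z2 ->
  (bellman (x - d) (y - e * d) z1 + bellman (x + d) (y + e * d) z2) / 2
  <= bellman x y ((z1 + z2) / 2).
Proof.
move=> he h1 h2.
have C1 := bellman_le1 (y - e * d) h1; have C2 := bellman_le1 (y + e * d) h2.
rewrite {3}/bellman; case: (leP 0 (_ / 2 + y)) => /= hw; first lra.
rewrite /bellman in C1 C2 *.
have h1' : `|x + - d| <= z1 by [].
have h2' : `|x - - d| <= z2 by rewrite opprK.
case: (leP 0 (z1 + _)) C1 => w1 C1; case: (leP 0 (z2 + _)) C2 => w2 C2.
- lra.
- have := bellman_midconcave_crossing he h2 h1 w2 w1 ltac:(lra).
  by rewrite (addrC z2); lra.
- have := @bellman_midconcave_crossing _ x y (- d) e z1 z2 he h1' h2'.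
  rewrite mulrN opprK => /(_ w1 w2 ltac:(lra)); lra.
- have p0 := sqrB_gt0_cone h1 w1; have q0 := sqrB_gt0_cone h2 w2.
  have := @sqr_div_midconvex _ (z1 + (y - e * d)) (z2 + (y + e * d)) _ _
     (y ^+ 2 - x ^+ 2) p0 q0.
  have e2 : 0 <= 1 - e ^+ 2.
    by rewrite -(real_normK (num_real e)); have := normr_ge0 e; nra.
  have : 0 <= (1 - e ^+ 2) * d ^+ 2 by rewrite mulr_ge0 ?sqr_ge0.
  move=> Q /(_ ltac:(nra)).
  have -> : (z1 + (y - e * d) + (z2 + (y + e * d))) / 2 = (z1 + z2) / 2 + y by field.
  lra.
Qed.

(** * Dyadic martingales as labelled trees *)

(** [Node d e l r] moves (x, y) by -(d, e d) in l and by +(d, e d) in r; a leaf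
    is an interval on which both functions are constant. *)
Inductive tree (R : Type) := Leaf | Node of R & R & tree R & tree R.
Arguments Leaf {R}.

Fixpoint tree_abs (R : realType) (T : tree R) (x : R) : R :=
  if T is Node d e l r then (tree_abs l (x - d) + tree_abs r (x + d)) / 2 else `|x|.

Fixpoint tree_nonneg (R : realType) (T : tree R) (y : R) : R :=
  if T is Node d e l r then (tree_nonneg l (y - e * d) + tree_nonneg r (y + e * d)) / 2
  else (0 <= y)%R%:R.

Fixpoint signs (R : realType) (E : set R) (T : tree R) : Prop :=
  if T is Node d e l r then [/\ E e, signs E l & signs E r] else True.

Lemma tree_abs_ge (R : realType) (T : tree R) (x : R) : `|x| <= tree_abs T x.
Proof.
elim: T x => [|d e l IHl r IHr] x //=.
have := IHl (x - d); have := IHr (x + d).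
have : `|2 * x| <= `|x - d| + `|x + d|.
  by rewrite (_ : 2 * x = (x - d) + (x + d)) ?ler_normD//; ring.
by rewrite normrM ger0_norm//; lra.
Qed.

Lemma tree_nonneg_ge0_le1 (R : realType) (T : tree R) (y : R) : 0 <= tree_nonneg T y <= 1.
Proof.
elim: T y => [|d e l IHl r IHr] y /=; first by rewrite ler0n lern1 leq_b1.
by have := IHl (y - e * d); have := IHr (y + e * d); lra.
Qed.

Lemma signsS (R : realType) (E E' : set R) (T : tree R) :
  E `<=` E' -> signs E T -> signs E' T.
Proof.
move=> EE'; elim: T => [|d e l IHl r IHr] //= [] /EE' h /IHl ? /IHr ?.
by split.
Qed.

Lemma tree_nonneg_le_bellman (R : realType) (T : tree R) (x y : R) :
  signs [set e | `|e| <= 1] T -> tree_nonneg T y <= bellman x y (tree_abs T x).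
Proof.
elim: T x y => [|d e l IHl r IHr] x y /=; first by move=> _; exact: bellman_ge_boundary.
move=> [he /IHl hl /IHr hr].
apply: le_trans (bellman_midconcave y he (tree_abs_ge l _) (tree_abs_ge r _)).
by have := hl (x - d) (y - e * d); have := hr (x + d) (y + e * d); lra.
Qed.

(** * The least biconcave function *)

(** Subtracting the chord leaves a midpoint concave function vanishing at 0 and
    1; since h s >= h (2 s) / 2 for s <= 1/2, and symmetrically, any lower
    bound - K improves to - K / 2, hence to 0. *)
Lemma midconcave_le_chord (R : realType) (g : R -> R) (t : R) :
  (forall s, 0 <= s <= 1 -> 0 <= g s) ->
  (forall s s', 0 <= s <= 1 -> 0 <= s' <= 1 ->
     (g s + g s') / 2 <= g ((s + s') / 2)) ->
  0 <= t <= 1 -> (1 - t) * g 0 + t * g 1 <= g t.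
Proof.
move=> g0 gmid t01.
pose K := g 0 + g 1.
have G0 : 0 <= g 0 by apply: g0; lra.
have G1 : 0 <= g 1 by apply: g0; lra.
have key n : forall s, 0 <= s <= 1 ->
    - K <= 2 ^+ n * (g s - ((1 - s) * g 0 + s * g 1)).
  elim: n => [|n IH] s s01.
    by rewrite expr0 mul1r /K; have := g0 _ s01; nra.
  rewrite exprSr -mulrA.
  have [s2|s2] := leP s (1 / 2).
  - have h2 : 0 <= 2 * s <= 1 by lra.
    have := gmid 0 (2 * s) ltac:(lra) h2.
    have -> : (0 + 2 * s) / 2 = s by field.
    move=> h; apply: le_trans (IH _ h2) _.
    by rewrite ler_wpM2l ?exprn_ge0//; lra.
  - have h2 : 0 <= 2 * s - 1 <= 1 by lra.
    have := gmid (2 * s - 1) 1 h2 ltac:(lra).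
    have -> : (2 * s - 1 + 1) / 2 = s by field.
    move=> h; apply: le_trans (IH _ h2) _.
    by rewrite ler_wpM2l ?exprn_ge0//; lra.
rewrite -subr_ge0 leNgt; apply/negP.
set h := _ - _ => h0.
have nh0 : 0 < - h by lra.
pose n := Num.bound (K / - h).
have : K / - h < n%:R.
  by apply: archi_boundP; rewrite divr_ge0 ?addr_ge0// ltW.
rewrite ltr_pdivrMr// => hn.
have n2 : n%:R <= 2 ^+ n :> R.
  by rewrite -natrX ler_nat ltnW// ltn_expl.
by have := key n _ t01; rewrite -/h; nra.
Qed.

(** The properties of the supremum, as a function of (x, y, z), on which the
    lower bound rests. *)
Record biconcave (R : realType) (f : R -> R -> R -> R) : Prop := Biconcave {
  bic_ge0 : forall x y z, `|x| <= z -> 0 <= f x y z;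
  bic_one : forall x y, 0 <= y -> 1 <= f x y `|x|;
  bic_mid : forall x y d e z1 z2, e = 1 \/ e = -1 ->
    `|x - d| <= z1 -> `|x + d| <= z2 ->
    (f (x - d) (y - e * d) z1 + f (x + d) (y + e * d) z2) / 2
    <= f x y ((z1 + z2) / 2) }.

Lemma biconcave_chord (R : realType) (f : R -> R -> R -> R)
    (bf : biconcave f) (x y z d e c t : R) : e = 1 \/ e = -1 ->
  `|x| <= z -> `|x + d| <= z + c -> 0 <= t <= 1 ->
  (1 - t) * f x y z + t * f (x + d) (y + e * d) (z + c)
  <= f (x + t * d) (y + t * (e * d)) (z + t * c).
Proof.
move=> he h0 h1 t01.
have in_cone s : 0 <= s <= 1 -> `|x + s * d| <= z + s * c.
  move=> s01; move: h0 h1; rewrite !ler_norml.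
  by move=> /andP[? ?] /andP[? ?]; apply/andP; split; nra.
pose g s := f (x + s * d) (y + s * (e * d)) (z + s * c).
have := @midconcave_le_chord _ g t; rewrite /g !mul0r !addr0 !mul1r; apply => //.
  by move=> s /in_cone; exact: bic_ge0.
move=> s s' /in_cone hs /in_cone hs'.
have := @bic_mid _ _ bf (x + (s + s') / 2 * d) (y + (s + s') / 2 * (e * d))
  ((s' - s) / 2 * d) e (z + s * c) (z + s' * c) he.
have -> : x + (s + s') / 2 * d - (s' - s) / 2 * d = x + s * d by field.
have -> : x + (s + s') / 2 * d + (s' - s) / 2 * d = x + s' * d by field.
have -> : y + (s + s') / 2 * (e * d) - e * ((s' - s) / 2 * d) = y + s * (e * d).
  by field.
have -> : y + (s + s') / 2 * (e * d) + e * ((s' - s) / 2 * d) = y + s' * (e * d).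
  by field.
have -> : (z + s * c + (z + s' * c)) / 2 = z + (s + s') / 2 * c by field.
exact.
Qed.

(** The points (x, y, z) - n (d, e d, - c) stay in the cone for all n because
    |d| <= c; (x, y, z) lies on the chord from such a point to the target, and
    the weight of the target tends to 1 while the other value is at least 0. *)
Lemma biconcave_ray (R : realType) (f : R -> R -> R -> R)
    (bf : biconcave f) (x y z d e c : R) : e = 1 \/ e = -1 ->
  `|x| <= z -> `|d| <= c -> `|x + d| <= z - c ->
  f (x + d) (y + e * d) (z - c) <= f x y z.
Proof.
move=> he h0 hd h1.
have key (n : nat) : n%:R * f (x + d) (y + e * d) (z - c) <= n.+1%:R * f x y z.
  have n0 : 0 <= n%:R :> R by [].
  have n1 : 0 < n%:R + 1 :> R by lra.
  have hA : `|x - n%:R * d| <= z + n%:R * c.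
    move: h0 hd; rewrite !ler_norml => /andP[? ?] /andP[? ?].
    by apply/andP; split; nra.
  have hB : `|x - n%:R * d + (n%:R + 1) * d| <= z + n%:R * c + - (n%:R + 1) * c.
    have -> : x - n%:R * d + (n%:R + 1) * d = x + d by ring.
    by have -> : z + n%:R * c + - (n%:R + 1) * c = z - c by ring.
  pose t : R := n%:R / (n%:R + 1).
  have t01 : 0 <= t <= 1.
    apply/andP; split; first by rewrite divr_ge0 ?(ltW n1).
    by rewrite ler_pdivrMr// mul1r; lra.
  have := biconcave_chord bf (y - n%:R * (e * d)) he hA hB t01.
  have -> : x - n%:R * d + t * ((n%:R + 1) * d) = x.
    by rewrite /t; field; rewrite gt_eqF.
  have -> : y - n%:R * (e * d) + t * (e * ((n%:R + 1) * d)) = y.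
    by rewrite /t; field; rewrite gt_eqF.
  have -> : z + n%:R * c + t * (- (n%:R + 1) * c) = z.
    by rewrite /t; field; rewrite gt_eqF.
  have -> : x - n%:R * d + (n%:R + 1) * d = x + d by ring.
  have -> : y - n%:R * (e * d) + e * ((n%:R + 1) * d) = y + e * d by ring.
  have -> : z + n%:R * c + - (n%:R + 1) * c = z - c by ring.
  have := bic_ge0 bf (y - n%:R * (e * d)) hA.
  set a := f _ _ _; set b := f _ _ _; set b' := f _ _ _ => a0 h.
  have : t * b <= b' by have : 0 <= (1 - t) * a; [rewrite mulr_ge0//; lra|lra].
  by rewrite /t mulrAC ler_pdivrMr// -natr1 (mulrC b').
rewrite leNgt; apply/negP; rewrite -subr_gt0 => D0.
have f0 := bic_ge0 bf y h0.
have := archi_boundP (divr_ge0 f0 (ltW D0)); set n := Num.bound _.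
rewrite ltr_pdivrMr//; have := key n; rewrite -natr1; lra.
Qed.

(** With p = (z + x) / 2, [biconcave_ray] allows two moves that preserve z + y:
    first to (p, z + y - p, p), then to (0, z + y, 0). *)
Lemma biconcave_ge1 (R : realType) (f : R -> R -> R -> R)
    (bf : biconcave f) (x y z : R) : `|x| <= z -> 0 <= z + y -> 1 <= f x y z.
Proof.
move=> hx hy.
have [x1 x2] : - z <= x /\ x <= z by apply/andP; rewrite -ler_norml.
pose s := (z - x) / 2; pose p := (z + x) / 2.
have s0 : 0 <= s by rewrite /s; lra.
have p0 : 0 <= p by rewrite /p; lra.
have xs : x + s = p by rewrite /s /p; field.
have zs : z - s = p by rewrite /s /p; field.
have := @biconcave_ray _ _ bf x y z s 1 s (or_introl erefl) hx.
rewrite xs zs ger0_norm// ger0_norm// lexx => /(_ isT (lexx _)).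
apply: le_trans.
have := @biconcave_ray _ _ bf p (y + 1 * s) p (- p) (-1) p (or_intror erefl).
rewrite normrN ger0_norm// !subrr normr0 lexx => /(_ isT isT (lexx _)).
apply: le_trans.
have := @bic_one _ _ bf 0 (y + 1 * s + -1 * - p); rewrite normr0; apply.
by rewrite /s /p; lra.
Qed.

(** Boundary points, with z = |x| = e x.  The point lies on the segment from
    (0, y - z, 0), where f >= 0, to (e q, - q, q), where f >= 1, with weight
    z / q on the latter, q = (z - y) / 2. *)
Lemma biconcave_ge_boundary (R : realType) (f : R -> R -> R -> R)
    (bf : biconcave f) (x y : R) (e : R) : (e = 1 \/ e = -1) -> 0 <= e * x ->
   e * x + y < 0 ->
  2 * (e * x) / (e * x - y) <= f x y (e * x).
Proof.
move=> he x0 xy.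
pose p := e * x; pose q := (p - y) / 2.
have ee : e * e = 1 by case: he => ->; ring.
have q0 : 0 < q by rewrite /q /p; lra.
pose t := p / q.
have t01 : 0 <= t <= 1.
  apply/andP; split; first by rewrite divr_ge0 ?(ltW q0).
  by rewrite ler_pdivrMr// mul1r /q /p; lra.
have ne : `|e| = 1 by case: he => ->; rewrite ?normrN normr1.
have h1 : `|0 + e * q| <= 0 + q.
  by rewrite !add0r normrM ne mul1r ger0_norm// ltW.
have h0 : `|0 : R| <= 0 by rewrite normr0.
have := biconcave_chord bf (y - p) he h0 h1 t01.
have -> : 0 + t * (e * q) = x.
  rewrite add0r /t mulrCA divfK ?gt_eqF//.
  by rewrite /p mulrA ee mul1r.
have -> : y - p + t * (e * (e * q)) = y.
  by rewrite (mulrA e) ee mul1r /t divfK ?gt_eqF//; ring.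
have -> : 0 + t * q = e * x by rewrite add0r /t divfK ?gt_eqF.
have -> : y - p + e * (e * q) = - q.
  by rewrite (mulrA e) ee mul1r /q; field.
rewrite !add0r.
have h2 : `|e * q| <= q by move: h1; rewrite !add0r.
have := bic_ge0 bf (y - p) h0.
have := @biconcave_ge1 _ _ bf (e * q) (- q) q h2; rewrite subrr lexx => /(_ isT).
set a := f _ _ _; set b := f _ _ _; set c := f _ _ _ => a1 b0 h.
have -> : 2 * (e * x) / (e * x - y) = t.
  by rewrite /t /q -/p; field; rewrite gt_eqF//; rewrite /p; lra.
have : 0 <= (1 - t) * b by rewrite mulr_ge0//; lra.
have : t * 1 <= t * a by rewrite ler_wpM2l//; case/andP: t01.
lra.
Qed.

(** When z + y < 0, put y1 = - y - x, y2 = x - y, w = - y - z, so that bellman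
    is 1 - w^2 / (y1 y2).  With y2 fixed this is linear along rays on which
    w / y1 is constant.  Such a ray starts at (y2 / 2, - y2 / 2, y2 / 2), where
    y1 = w = 0, and meets the boundary z = - x where y1 = Y. *)
Lemma bellman_le_biconcave (R : realType) (f : R -> R -> R -> R)
    (bf : biconcave f) (x y z : R) : `|x| <= z -> bellman x y z <= f x y z.
Proof.
move=> hx; rewrite /bellman; case: (leP 0 (z + y)) => hy; first exact: (biconcave_ge1 bf).
have Q0 := sqrB_gt0_cone hx hy.
have [x1 x2] : - z <= x /\ x <= z by apply/andP; rewrite -ler_norml.
pose y1 := - y - x; pose y2 := x - y; pose w := - y - z.
have y10 : 0 < y1 by rewrite /y1; lra.
have y20 : 0 < y2 by rewrite /y2; lra.
have w0 : 0 < w by rewrite /w; lra.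
pose Y := y1 * y2 / w; pose t := w / y2.
have y2Y : y2 <= Y.
  by rewrite /Y ler_pdivlMr// mulrC ler_wpM2r ?(ltW y20)// /w /y1; lra.
have tY : t * Y = y1 by rewrite /t /Y; field; rewrite !gt_eqF.
have ty : t * y2 = w by rewrite /t divfK ?gt_eqF.
have t01 : 0 <= t <= 1.
  apply/andP; split; first by rewrite divr_ge0 ?ltW.
  by rewrite ler_pdivrMr// mul1r /w /y2; lra.
have h0 : `|y2 / 2| <= y2 / 2 by rewrite ger0_norm//; lra.
have h1 : `|y2 / 2 + - (Y / 2)| <= y2 / 2 + (Y / 2 - y2).
  by rewrite ler0_norm; lra.
have := biconcave_chord bf (- (y2 / 2)) (or_introl erefl) h0 h1 t01.
have -> : y2 / 2 + t * (- (Y / 2)) = x.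
  by rewrite mulrN mulrA tY /y1 /y2; field.
have -> : - (y2 / 2) + t * (1 * - (Y / 2)) = y.
  by rewrite mul1r mulrN mulrA tY /y1 /y2; field.
have -> : y2 / 2 + t * (Y / 2 - y2) = z.
  by rewrite mulrBr ty mulrA tY /y1 /y2 /w; field.
have -> : y2 / 2 + (Y / 2 - y2) = - 1 * (y2 / 2 + - (Y / 2)) by field.
have := @biconcave_ge1 _ _ bf (y2 / 2) (- (y2 / 2)) (y2 / 2) h0; rewrite subrr lexx => /(_ isT).
have := @biconcave_ge_boundary _ _ bf (y2 / 2 + - (Y / 2)) (- (y2 / 2) + 1 * - (Y / 2)) (-1)
  (or_intror erefl) ltac:(lra) ltac:(lra).
have -> : 2 * (-1 * (y2 / 2 + - (Y / 2))) /
  (-1 * (y2 / 2 + - (Y / 2)) - (- (y2 / 2) + 1 * - (Y / 2))) = 1 - y2 / Y.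
  by field; rewrite gt_eqF//; lra.
set a := f _ _ _; set b := f _ _ _; set c := f _ _ _ => ha hb h.
have -> : 1 - (z + y) ^+ 2 / (y ^+ 2 - x ^+ 2) = 1 - t * (y2 / Y).
  have -> : y ^+ 2 - x ^+ 2 = y1 * y2 by rewrite /y1 /y2; ring.
  have -> : z + y = - w by rewrite /w; ring.
  by rewrite /t /Y; field; rewrite !gt_eqF.
have : t * (1 - y2 / Y) <= t * a by rewrite ler_wpM2l//; case/andP: t01.
have : (1 - t) * 1 <= (1 - t) * b by rewrite ler_wpM2l//; lra.
lra.
Qed.

(** * The supremum over trees *)

Definition tree_values (R : realType) (E : set R) (x y z : R) : set R :=
  [set v | exists T, [/\ signs E T, tree_abs T x = z & tree_nonneg T y = v]].

(** A single step of size z at the root turns x into x - z and x + z, whose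
    absolute values average to z. *)
Lemma has_sup_tree_values (R : realType) (E : set R) (x y z : R) :
  E !=set0 -> `|x| <= z -> has_sup (tree_values E x y z).
Proof.
move=> [e he] hx; split; last first.
  by exists 1 => _ [T [_ _ <-]]; case/andP: (tree_nonneg_ge0_le1 T y).
exists (tree_nonneg (Node z e Leaf Leaf) y), (Node z e Leaf Leaf); split => //=.
move: hx; rewrite ler_norml => /andP[x1 x2].
have -> : `|x - z| = z - x by rewrite ler0_norm; lra.
have -> : `|x + z| = x + z by rewrite ger0_norm; lra.
by field.
Qed.

Lemma tree_nonneg_le_sup (R : realType) (E : set R) (T : tree R) (x y z : R) :
  signs E T -> tree_abs T x = z -> tree_nonneg T y <= sup (tree_values E x y z).
Proof.
move=> sT tT; apply: ub_le_sup; last by exists T.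
by exists 1 => _ [T' [_ _ <-]]; case/andP: (tree_nonneg_ge0_le1 T' y).
Qed.

(** Midpoint concavity is grafting: near-optimal trees for the two endpoints
    become the children of a new root. *)
Lemma biconcave_sup_tree (R : realType) (E : set R) :
  E 1 -> E (-1) ->
  biconcave (fun x y z => sup (tree_values E x y z)).
Proof.
move=> E1 EN1; have E0 : E !=set0 by exists 1.
split => [x y z hx|x y hy|x y d e z1 z2 he h1 h2].
- have h := has_sup_tree_values y E0 hx.
  have [[v [T [sT tT _]]] _] := h.
  apply: le_trans (tree_nonneg_le_sup y sT tT).
  by case/andP: (tree_nonneg_ge0_le1 T y).
- apply: le_trans (@tree_nonneg_le_sup _ E Leaf x y `|x| I erefl).
  by rewrite /= hy.
- set s := sup (tree_values E x y _).
  have key T1 T2 : signs E T1 -> signs E T2 -> tree_abs T1 (x - d) = z1 ->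
      tree_abs T2 (x + d) = z2 -> tree_nonneg T1 (y - e * d) + tree_nonneg T2 (y + e * d) <= 2 * s.
    move=> s1 s2 t1 t2.
    have : (tree_nonneg T1 (y - e * d) + tree_nonneg T2 (y + e * d)) / 2 <= s; last lra.
    apply: (@tree_nonneg_le_sup _ E (Node d e T1 T2)); last by rewrite /= t1 t2.
    by split => //; case: he => ->.
  have [n1 _] := has_sup_tree_values (y - e * d) E0 h1.
  have [n2 _] := has_sup_tree_values (y + e * d) E0 h2.
  suff : sup (tree_values E (x + d) (y + e * d) z2)
         <= 2 * s - sup (tree_values E (x - d) (y - e * d) z1) by lra.
  apply: ge_sup => // _ [T2 [s2 t2 <-]].
  suff : sup (tree_values E (x - d) (y - e * d) z1)
         <= 2 * s - tree_nonneg T2 (y + e * d) by lra.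
  apply: ge_sup => // _ [T1 [s1 t1 <-]].
  by have := key _ _ s1 s2 t1 t2; lra.
Qed.

Lemma sup_tree_values (R : realType) (E : set R) (x y z : R) :
  E 1 -> E (-1) -> (forall e, E e -> `|e| <= 1) -> `|x| <= z ->
  sup (tree_values E x y z) = bellman x y z.
Proof.
move=> E1 EN1 Ele hx; apply/eqP; rewrite eq_le.
rewrite (bellman_le_biconcave (biconcave_sup_tree E1 EN1))// andbT.
have [n _] := has_sup_tree_values y (ex_intro _ 1 E1) hx.
apply: ge_sup => // _ [T [sT <- <-]].
by apply: tree_nonneg_le_bellman; exact: signsS sT.
Qed.

(** * Integrals of dyadic step functions *)

Local Notation mu := (@lebesgue_measure _).

Lemma natrS (R : realType) (n : nat) : n.+1%:R = n%:R + 1 :> R.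
Proof. by rewrite natr1. Qed.

Lemma natr_double (R : realType) (n : nat) : (n.*2)%:R = n%:R * 2 :> R.
Proof. by rewrite -muln2 natrM. Qed.

Definition cell (R : realType) (m k : nat) : set R :=
  `[k%:R / 2 ^+ m, k.+1%:R / 2 ^+ m[%classic.

(** Average of G over the 2^n descendants, n generations below, of cell k. *)
Fixpoint cell_avg (R : realType) (n : nat) (G : nat -> R) (k : nat) : R :=
  if n is n'.+1 then
    (cell_avg n' G k.*2 + cell_avg n' G k.*2.+1) / 2
  else G k.

Lemma in_cell (R : realType) (m k : nat) (t : R) :
  cell m k t <-> k%:R <= t * 2 ^+ m < k.+1%:R.
Proof.
rewrite /cell /= in_itv /=.
by rewrite ler_pdivrMr ?exprn_gt0// ltr_pdivlMr ?exprn_gt0.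
Qed.

Lemma in_cell_inj (R : realType) (m j k : nat) (t : R) :
  cell m j t -> cell m k t -> j = k.
Proof.
move=> /in_cell/andP[a b] /in_cell/andP[c d].
have := le_lt_trans a d; have := le_lt_trans c b.
rewrite !ltr_nat; lia.
Qed.

Lemma cell_half (R : realType) (m j : nat) (t : R) :
  cell m.+1 j t -> cell m j./2 t.
Proof.
move=> /in_cell/andP[]; rewrite exprSr mulrA => a b.
have h1 : ((j./2).*2)%:R <= j%:R :> R by rewrite ler_nat; lia.
have h2 : j.+1%:R <= ((j./2).*2)%:R + 2 :> R by rewrite -natrD ler_nat; lia.
move: h1 h2; rewrite -muln2 natrM => h1 h2.
by apply/in_cell; rewrite -natr1; apply/andP; split; lra.
Qed.

Lemma cellU (R : realType) (m k : nat) :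
  @cell R m k = cell m.+1 k.*2 `|` cell m.+1 k.*2.+1.
Proof.
apply/seteqP; split => t; last first.
  have e2 : (k.*2.+1)./2 = k by lia.
  by case=> /cell_half; rewrite ?doubleK ?e2.
move=> /in_cell/andP[a b].
have e : t * 2 ^+ m.+1 = t * 2 ^+ m * 2 by rewrite exprSr mulrA.
have e0 : (k.*2)%:R = k%:R * 2 :> R by rewrite -muln2 natrM.
rewrite (natrS _ k) in b.
have [h|h] := ltP (t * 2 ^+ m.+1) (k.*2.+1)%:R; [left|right]; apply/in_cell.
  by apply/andP; split; lra.
rewrite (natrS _ k.*2) in h; rewrite (natrS _ k.*2.+1) (natrS _ k.*2); apply/andP; split; lra.
Qed.

Lemma cell_disj (R : realType) (m j k : nat) :
  j <> k -> [disjoint @cell R m j & cell m k].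
Proof.
by move=> jk; apply/disj_setPS => t [] h h'; case: jk; exact: in_cell_inj h h'.
Qed.

Lemma measurable_cell (R : realType) (m k : nat) : measurable (@cell R m k).
Proof. exact: measurable_itv. Qed.

Lemma measure_cell (R : realType) (m k : nat) :
  mu (@cell R m k) = ((2 ^+ m)^-1)%:E.
Proof.
rewrite /cell lebesgue_measure_itv/= lte_fin ltr_pM2r ?invr_gt0 ?exprn_gt0//.
by rewrite ltr_nat ltnSn -EFinB -mulrBl -natr1 addrAC subrr add0r mul1r.
Qed.

Lemma measure_cell_lty (R : realType) (m k : nat) : (mu (@cell R m k) < +oo)%E.
Proof. by rewrite measure_cell ltry. Qed.

Definition step_on (R : realType) (N : nat) (f : R -> R) (G : nat -> R) :=
  forall j t, (j < 2 ^ N)%N -> cell N j t -> f t = G j.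

(** By induction on n, since each cell is the disjoint union of its halves.
    Integrability is carried along as measurability and boundedness. *)
Lemma step_integral (R : realType) (n m k : nat) (f : R -> R) (G : nat -> R) :
  (k < 2 ^ m)%N -> step_on (m + n) f G ->
  [/\ measurable_fun (cell m k) f,
      mu.-integrable (cell m k) (EFin \o f) &
      \int[mu]_(t in cell m k) f t = (2 ^+ m)^-1 * cell_avg n G k].
Proof.
suff H : (k < 2 ^ m)%N -> step_on (m + n) f G ->
  [/\ measurable_fun (cell m k) f,
      exists M, forall t, cell m k t -> `|f t| <= M &
      \int[mu]_(t in cell m k) f t = (2 ^+ m)^-1 * cell_avg n G k].
  move=> km /(H km)[mf [M fM] If]; split=> //.
  apply: measurable_bounded_integrable => //; first exact: measurable_cell.
    exact: measure_cell_lty.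
  exists M; split; rewrite ?num_real// => x Mx t ct /=.
  by apply: le_trans (ltW Mx); exact: fM.
elim: n m k => [|n IH] m k km Hf.
  rewrite addn0 in Hf.
  have fG t : t \in cell m k -> f t = G k.
    by rewrite inE; exact: Hf.
  split.
  - by apply: eq_measurable_fun (measurable_cst (G k)) => t /fG ->.
  - by exists `|G k| => t /mem_set/fG ->.
  - rewrite (@eq_Rintegral _ _ _ _ _ (cst (G k)))//.
    rewrite Rintegral_cst; last exact: measurable_cell.
    by rewrite [X in fine X]measure_cell mulrC.
rewrite addnS -addSn in Hf.
have k1 : (k.*2 < 2 ^ m.+1)%N by rewrite expnS; lia.
have k2 : (k.*2.+1 < 2 ^ m.+1)%N by rewrite expnS; lia.
have [m1 [M1 b1] I1] := IH m.+1 k.*2 k1 Hf.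
have [m2 [M2 b2] I2] := IH m.+1 k.*2.+1 k2 Hf.
have mc := @measurable_cell R.
have mf : measurable_fun (cell m k) f.
  by rewrite cellU; apply/measurable_funU.
have bf : exists M, forall t, cell m k t -> `|f t| <= M.
  by exists (Num.max M1 M2) => t; rewrite cellU => -[/b1|/b2] h;
    rewrite le_max h ?orbT.
split => //.
rewrite cellU Rintegral_setU ?I1 ?I2//.
- by rewrite /= exprS; field; rewrite expf_neq0.
- exact: mc.
- exact: mc.
- rewrite -cellU; apply: measurable_bounded_integrable => //.
    exact: mc.
  exact: measure_cell_lty.
  case: bf => M fM; exists M; split; rewrite ?num_real// => x Mx t ct /=.
  by apply: le_trans (ltW Mx); exact: fM.
- by apply: cell_disj; lia.
Qed.

Lemma unitI_cell (R : realType) : unitI R = cell 0 0 `|` [set 1].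
Proof.
rewrite /unitI /cell expr0 !divr1; apply/seteqP; split => t /=; rewrite !in_itv/=.
  by rewrite [t <= 1]le_eqVlt => /andP[-> /predU1P[->|->]]; [right|left].
by case=> [/andP[-> /ltW]//|->]; rewrite lexx ler01.
Qed.

Lemma cell_sub_unitI (R : realType) (m k : nat) :
  (k < 2 ^ m)%N -> cell m k `<=` unitI R.
Proof.
move=> km t /in_cell/andP[h1 h2]; rewrite /unitI /= in_itv /=.
have p0 : 0 < (2 ^+ m : R) by rewrite exprn_gt0.
apply/andP; split; first by rewrite -(pmulr_lge0 _ p0) (le_trans _ h1).
rewrite -(ler_pM2r p0) mul1r (le_trans (ltW h2))//.
by rewrite -natrX ler_nat.
Qed.

Lemma lenI1 (R : realType) : lenI R = 1.
Proof. by rewrite /lenI /unitI lebesgue_measure_itv/= lte_fin ltr01 -EFinB subr0. Qed.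

Lemma Rintegral_unitI (R : realType) (f : R -> R) :
  mu.-integrable (cell 0 0) (EFin \o f) ->
  \int[mu]_(t in unitI R) f t = \int[mu]_(t in cell 0 0) f t.
Proof.
rewrite /unitI /cell expr0 !divr1 => fi.
by rewrite -Rintegral_itv_bndo_bndc.
Qed.

Lemma mean_step (R : realType) (N : nat) (f : R -> R) (G : nat -> R) :
  step_on N f G -> mean f = cell_avg N G 0.
Proof.
move=> Hf; have [_ fi If] := @step_integral R N 0 0 f G isT Hf.
by rewrite /mean lenI1 invr1 mul1r Rintegral_unitI// If expr0 invr1 mul1r.
Qed.

(** The measure of the set where f >= 0 is the integral of the step function
    with value 1 or 0 according to the sign of f. *)
Lemma nonneg_frac_step (R : realType) (N : nat) (f : R -> R) (G : nat -> R) :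
  step_on N f G ->
  nonneg_frac f = cell_avg N (fun j => (0 <= G j)%R%:R) 0.
Proof.
move=> Hf; have [mf _ _] := @step_integral R N 0 0 f G isT Hf.
pose g t : R := (0 <= f t)%R%:R.
have Hg : step_on N g (fun j => (0 <= G j)%R%:R).
  by move=> j t jN ct; rewrite /g (Hf j).
rewrite -(mean_step Hg) /nonneg_frac /mean !lenI1 invr1 !mul1r.
have mfI : measurable_fun (unitI R) f.
  rewrite unitI_cell; apply/measurable_funU => //; first exact: measurable_cell.
  by split => //; exact: measurable_fun_set1.
set A := [set t | _].
have mA : measurable A.
  have -> : A = unitI R `&` f @^-1` `[0, +oo[%classic.
    by apply/seteqP; split => t /=; rewrite in_itv/= andbT.
  by apply: mfI; exact: measurable_itv.
have -> : \int[mu]_(t in unitI R) g t = \int[mu]_(t in unitI R) \1_A t.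
  apply: eq_Rintegral => t; rewrite inE => It; rewrite /g indicE; congr (_%:R).
  by congr nat_of_bool; apply/idP/idP; rewrite inE /A /=; [|case].
rewrite /Rintegral integral_indic//.
by congr (fine (mu _)); apply/seteqP; split => t; [move=> At; split; [|case: At]|case].
exact: measurable_itv.
Qed.

(** * Finite Haar sums as martingales *)

(** Value on cell (n, k) of the martingale started at x whose increment on the
    two halves of cell (m, j) is - d m j on the left and + d m j on the
    right. *)
Fixpoint mart (R : realType) (d : nat -> nat -> R) (x : R) (n k : nat) : R :=
  if n is n'.+1 then
    mart d x n' k./2 + (if odd k then d n' k./2 else - d n' k./2)
  else x.

Lemma mart_left (R : realType) (d : nat -> nat -> R) (x : R) (n k : nat) :
  mart d x n.+1 k.*2 = mart d x n k - d n k.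
Proof. by rewrite /= odd_double doubleK. Qed.

Lemma mart_right (R : realType) (d : nat -> nat -> R) (x : R) (n k : nat) :
  mart d x n.+1 k.*2.+1 = mart d x n k + d n k.
Proof.
have e : (k.*2.+1)./2 = k by lia.
by rewrite /= -[uphalf _]/((k.*2.+1)./2) e odd_double.
Qed.

Lemma mart_start (R : realType) (d : nat -> nat -> R) (x : R) (n k : nat) :
  mart d x n k = x + mart d 0 n k.
Proof. by elim: n k => [|n IH] k /=; rewrite ?addr0// IH addrA. Qed.

Lemma cell_avg_mart (R : realType) (d : nat -> nat -> R) (x : R) (n m k : nat) :
  cell_avg n (mart d x (m + n)) k = mart d x m k.
Proof.
elim: n m k => [|n IH] m k; first by rewrite addn0.
by rewrite /= addnS -addSn !IH mart_left mart_right; field.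
Qed.

Lemma cell_avgZ (R : realType) (a : R) (G : nat -> R) (n k : nat) :
  cell_avg n (fun j => a * G j) k = a * cell_avg n G k.
Proof. by elim: n k => [|n IH] k //=; rewrite !IH; field. Qed.

Lemma step_on_widen (R : realType) (N N' : nat) (f : R -> R) (G : nat -> R) :
  step_on N f G -> (N <= N')%N -> exists G', step_on N' f G'.
Proof.
move=> Hf /subnK <-; elim: (N' - N)%N => [|n [G' IH]]; first by exists G.
exists (fun j => G' j./2) => j t jn /cell_half; apply: IH.
by move: jn; rewrite addSn expnS; lia.
Qed.

Lemma dlen_gt0 (R : realType) (J : dyadic) : 0 < dlen R J.
Proof. by rewrite /dlen invr_gt0 exprn_gt0. Qed.

Lemma haar_cell (R : realType) (J : dyadic) (j : nat) (t : R) :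
  cell (tag J).+1 j t ->
  haar J t = if j./2 == tagged J :> nat
    then (if odd j then 1 else -1) * (Num.sqrt (dlen R J))^-1 else 0.
Proof.
case: J => n k; rewrite /haar /dright /dmid /dleft /dlen /= => ct.
set s := (Num.sqrt _)^-1.
have p0 : (2 ^+ n : R) != 0 by rewrite expf_neq0.
have e1 : k%:R * (2 ^+ n)^-1 = (k.*2)%:R / 2 ^+ n.+1 :> R.
  by rewrite natr_double exprSr; field.
have e2 : k%:R * (2 ^+ n)^-1 + (2 ^+ n)^-1 / 2 = (k.*2.+1)%:R / 2 ^+ n.+1 :> R.
  by rewrite (natrS _ k.*2) natr_double exprSr; field.
have e3 : k%:R * (2 ^+ n)^-1 + (2 ^+ n)^-1 = (k.*2.+2)%:R / 2 ^+ n.+1 :> R.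
  by rewrite (natrS _ k.*2.+1) (natrS _ k.*2) natr_double exprSr; field.
rewrite e2 e3 e1.
have inc i : (i%:R / 2 ^+ n.+1 <= t < i.+1%:R / 2 ^+ n.+1) = (i == j).
  apply/idP/eqP => [h|->]; last by move: ct; rewrite /cell /= in_itv.
  by apply: in_cell_inj ct; rewrite /cell /= in_itv.
rewrite !inc.
have -> : (k.*2.+1 == j) = odd j && (j./2 == k) by lia.
have -> : (k.*2 == j) = ~~ odd j && (j./2 == k) by lia.
by case: (j./2 == k); case: (odd j); rewrite /= ?mul1r ?mulN1r.
Qed.

Lemma haar_right (R : realType) (J : dyadic) (t : R) :
  cell (tag J).+1 (tagged J).*2.+1 t -> haar J t = (Num.sqrt (dlen R J))^-1.
Proof.
move=> /haar_cell ->.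
have -> : (tagged J).*2.+1./2 = tagged J by lia.
by rewrite eqxx /= odd_double mul1r.
Qed.

Lemma haar_left (R : realType) (J : dyadic) (t : R) :
  cell (tag J).+1 (tagged J).*2 t -> haar J t = - (Num.sqrt (dlen R J))^-1.
Proof. by move=> /haar_cell ->; rewrite doubleK eqxx odd_double mulN1r. Qed.

Lemma haar_out (R : realType) (J : dyadic) (t : R) :
  ~ cell (tag J) (tagged J) t -> haar J t = 0.
Proof.
case: J => n k; rewrite /haar /dright /dmid /dleft /dlen /= => nc.
have p0 : 0 < (2 ^+ n : R)^-1 by rewrite invr_gt0 exprn_gt0.
case: ifPn => [/andP[h1 h2]|_].
  case: nc; rewrite /cell /= in_itv /= (natrS _ k) mulrDl mul1r h2 andbT; lra.
case: ifPn => [/andP[h1 h2]|//].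
case: nc; rewrite /cell /= in_itv /= (natrS _ k) mulrDl mul1r h1 /=; lra.
Qed.

Lemma haar1 (R : realType) (J : dyadic) : haar J (1 : R) = 0.
Proof.
apply: haar_out => /in_cell/andP[_]; rewrite mul1r.
by apply/negP; rewrite -leNgt -natrX ler_nat.
Qed.

Definition dyad (n : nat) (k : 'I_(2 ^ n)) : dyadic := existT _ n k.

(** Listed level by level, so that Haar sums unfold along the recursion of
    [mart]. *)
Fixpoint dyadics_below (N : nat) : seq dyadic :=
  if N is N'.+1 then dyadics_below N' ++ [seq dyad k | k <- enum 'I_(2 ^ N')]
  else [::].

Lemma mem_dyadics_below (N : nat) (J : dyadic) :
  (J \in dyadics_below N) = (tag J < N)%N.
Proof.
elim: N => [|N IH] //=; rewrite mem_cat IH ltnS [RHS]leq_eqVlt orbC.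
congr orb; apply/mapP/eqP => [[k _ ->] //|].
by case: J {IH} => n k /= e; subst n; exists k; rewrite ?mem_enum.
Qed.

Lemma uniq_dyadics_below (N : nat) : uniq (dyadics_below N).
Proof.
elim: N => [|N IH] //=; rewrite cat_uniq IH /= map_inj_uniq ?enum_uniq ?andbT.
  by apply/hasPn => _ /mapP[k _ ->]; rewrite /= mem_dyadics_below ltnn.
by move=> i j /eqP; rewrite /dyad eq_Tagged /= => /eqP.
Qed.

Lemma big_dyadics (R : realType) (F : {fset dyadic}) (N : nat) (g : dyadic -> R) :
  (forall J, J \in F -> (tag J < N)%N) ->
  \sum_(J <- F) g J = \sum_(J <- dyadics_below N | J \in F) g J.
Proof.
move=> FN; rewrite -[RHS]big_filter; apply: perm_big; apply: uniq_perm.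
- exact: fset_uniq.
- by rewrite filter_uniq// uniq_dyadics_below.
- move=> J; rewrite mem_filter mem_dyadics_below.
  by apply/idP/andP => [h|[]//]; split => //; exact: FN.
Qed.

(** On a given cell of level N exactly one interval of each coarser level
    contributes, its Haar function having the sign of the half that contains
    the cell. *)
Lemma haar_sum_cell (R : realType) (c : dyadic -> R) (d : nat -> nat -> R)
    (N j : nat) (t : R) :
  (forall J, c J / Num.sqrt (dlen R J) = d (tag J) (tagged J)) ->
  (j < 2 ^ N)%N -> cell N j t ->
  \sum_(J <- dyadics_below N) c J * haar J t = mart d 0 N j.
Proof.
move=> cd; elim: N j => [|N IH] j jN ct; first by rewrite big_nil.
have hN : (j./2 < 2 ^ N)%N by move: jN; rewrite expnS; lia.
rewrite big_cat /= (IH _ hN (cell_half ct)); congr (_ + _).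
rewrite big_map big_enum /= (bigD1 (Ordinal hN))//= big1 ?addr0.
  rewrite (haar_cell (J := dyad (Ordinal hN)) ct)/= eqxx mulrCA.
  have -> : c (dyad (Ordinal hN)) / Num.sqrt (dlen R (dyad (Ordinal hN)))
     = d N j./2 by exact: cd.
  by case: (odd j); rewrite ?mul1r ?mulN1r.
move=> i ij; rewrite (haar_cell (J := dyad i) ct)/= ifN ?mulr0//.
by apply: contraNneq ij => e; apply/eqP/val_inj.
Qed.

Lemma step_on_haar_sum (R : realType) (c : dyadic -> R) (d : nat -> nat -> R)
    (N : nat) (x : R) (f : R -> R) :
  (forall J, c J / Num.sqrt (dlen R J) = d (tag J) (tagged J)) ->
  (forall t, unitI R t -> f t = x + \sum_(J <- dyadics_below N) c J * haar J t) ->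
  step_on N f (mart d x N).
Proof.
move=> cd Hf j t jN ct; rewrite Hf ?(haar_sum_cell cd jN ct) -?mart_start//.
exact: cell_sub_unitI jN _ ct.
Qed.

(** Orthogonality of the Haar system, in martingale form: the averages of f
    over the halves of J are the martingale values one level below J, and
    their difference is twice the increment at J. *)
Lemma haar_coef_step (R : realType) (d : nat -> nat -> R) (N : nat) (x : R)
    (f : R -> R) (J : dyadic) :
  step_on N f (mart d x N) -> (tag J < N)%N ->
  haar_coef f J = d (tag J) (tagged J) * Num.sqrt (dlen R J).
Proof.
move=> Hf JN; rewrite /haar_coef.
set n := tag J; set k : nat := tagged J; set s := Num.sqrt (dlen R J).
have kn : (k < 2 ^ n)%N by exact: ltn_ord.
have k1 : (k.*2 < 2 ^ n.+1)%N by rewrite expnS; lia.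
have k2 : (k.*2.+1 < 2 ^ n.+1)%N by rewrite expnS; lia.
pose G0 j : R := if j./2 == k then (if odd j then 1 else -1) * s^-1 else 0.
have h0 : step_on n.+1 (haar J) G0 by move=> j t _ /haar_cell.
have [G1 h1] := step_on_widen h0 JN.
have h2 : step_on (n + (N - n)) (fun t => f t * haar J t)
    (fun j => mart d x N j * G1 j).
  rewrite subnKC; last exact: ltnW.
  by move=> j t jN ct; rewrite (Hf j t jN ct) (h1 j t jN ct).
have [_ fi _] := step_integral kn h2.
have NE : (N = n.+1 + (N - n.+1))%N by rewrite subnKC.
have half i (a : R) : (i < 2 ^ n.+1)%N ->
    (forall t, cell n.+1 i t -> haar J t = a) ->
    \int[mu]_(t in cell n.+1 i) (f t * haar J t) =
    (2 ^+ n.+1)^-1 * (a * mart d x n.+1 i).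
  move=> hi ha.
  have h3 : step_on (n.+1 + (N - n.+1)) (fun t => a * f t)
      (fun j => a * mart d x (n.+1 + (N - n.+1)) j).
    by rewrite -NE => j t jN ct; rewrite (Hf j t jN ct).
  have [_ _] := step_integral hi h3.
  rewrite cell_avgZ cell_avg_mart => <-.
  by apply: eq_Rintegral => t /set_mem/ha ->; rewrite mulrC.
(* The Haar function vanishes off J, so only the cell J matters. *)
have -> : \int[mu]_(t in unitI R) (f t * haar J t)
        = \int[mu]_(t in cell n k) (f t * haar J t).
  have -> : cell n k = unitI R `&` cell n k.
    exact/esym/setIidr/cell_sub_unitI.
  rewrite Rintegral_mkcondr; apply: eq_Rintegral => t _.
  by rewrite patchE; case: ifPn => // /negP h; rewrite haar_out ?mulr0// => /mem_set.
rewrite cellU Rintegral_setU.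
- rewrite (half _ _ k1 (@haar_left R J)) (half _ _ k2 (@haar_right R J)).
  rewrite mart_left mart_right -/s.
  have s0 : 0 < s by rewrite sqrtr_gt0 dlen_gt0.
  have s2 : (2 ^+ n)^-1 = s ^+ 2 by rewrite sqr_sqrtr ?ltW ?dlen_gt0.
  by rewrite exprS invfM s2; field; rewrite gt_eqF.
- exact: measurable_cell.
- exact: measurable_cell.
- by rewrite -cellU.
- by apply: cell_disj; lia.
Qed.

(** * Admissible pairs and trees *)

(** The tree of depth n that a family of steps and signs induces below cell
    (m, k). *)
Fixpoint mktree (R : realType) (d e : nat -> nat -> R) (n m k : nat) : tree R :=
  if n is n'.+1 then
    Node (d m k) (e m k) (mktree d e n' m.+1 k.*2) (mktree d e n' m.+1 k.*2.+1)
  else Leaf.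

Lemma tree_abs_mktree (R : realType) (d e : nat -> nat -> R) (x : R) (n m k : nat) :
  tree_abs (mktree d e n m k) (mart d x m k)
  = cell_avg n (fun j => `|mart d x (m + n) j|) k.
Proof.
elim: n m k => [|n IH] m k; first by rewrite addn0.
by rewrite /= -mart_left -mart_right !IH addnS -addSn.
Qed.

Lemma tree_nonneg_mktree (R : realType) (d e : nat -> nat -> R) (y : R) (n m k : nat) :
  tree_nonneg (mktree d e n m k) (mart (fun m k => e m k * d m k) y m k)
  = cell_avg n (fun j => (0 <= mart (fun m k => e m k * d m k) y (m + n) j)%R%:R) k.
Proof.
elim: n m k => [|n IH] m k; first by rewrite addn0.
rewrite /= -(mart_left (fun m k => e m k * d m k)).
by rewrite -(mart_right (fun m k => e m k * d m k)) !IH addnS -addSn.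
Qed.

Lemma signs_mktree (R : realType) (E : set R) (d e : nat -> nat -> R) (n m k : nat) :
  (forall m k, E (e m k)) -> signs E (mktree d e n m k).
Proof. by move=> Ee; elim: n m k => [|n IH] m k //=; split. Qed.

Definition root_step (R : realType) (T : tree R) : R :=
  if T is Node d _ _ _ then d else 0.

(** The default sign 1 at a leaf keeps all signs in every set containing 1; the
    step there is 0. *)
Definition root_sign (R : realType) (T : tree R) : R :=
  if T is Node _ e _ _ then e else 1.

Definition child (R : Type) (b : bool) (T : tree R) : tree R :=
  if T is Node _ _ l r then (if b then r else l) else Leaf.

(** Descends from the root along the binary digits of k. *)
Fixpoint subtree (R : Type) (T : tree R) (n k : nat) : tree R :=
  if n is n'.+1 then child (odd k) (subtree T n' k./2) else T.

Fixpoint depth (R : Type) (T : tree R) : nat :=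
  if T is Node _ _ l r then (maxn (depth l) (depth r)).+1 else 0.

Lemma subtree_left (R : Type) (T : tree R) (n k : nat) :
  subtree T n.+1 k.*2 = child false (subtree T n k).
Proof. by rewrite /= odd_double doubleK. Qed.

Lemma subtree_right (R : Type) (T : tree R) (n k : nat) :
  subtree T n.+1 k.*2.+1 = child true (subtree T n k).
Proof.
have e : (k.*2.+1)./2 = k by lia.
by rewrite /= -[uphalf _]/((k.*2.+1)./2) e odd_double.
Qed.

Lemma depth_child (R : Type) (b : bool) (T : tree R) (n : nat) :
  (depth T <= n.+1)%N -> (depth (child b T) <= n)%N.
Proof. by case: T => [|d e l r] //=; rewrite ltnS geq_max; case: b => /andP[]. Qed.

Lemma signs_subtree (R : realType) (E : set R) (T : tree R) (n k : nat) :
  signs E T -> signs E (subtree T n k).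
Proof.
move=> sT; elim: n k => [|n IH] k //=.
by move: (IH k./2); case: (subtree _ _ _) => //= d e l r []; case: (odd k).
Qed.

Definition node_step (R : realType) (T : tree R) (m k : nat) : R :=
  root_step (subtree T m k).

Definition node_sign (R : realType) (T : tree R) (m k : nat) : R :=
  root_sign (subtree T m k).

(** Reading steps and signs off the nodes of T and building the induced tree
    only pads T with null steps, which change neither average. *)
Lemma tree_abs_subtree (R : realType) (T : tree R) (n m k : nat) (x : R) :
  (depth (subtree T m k) <= n)%N ->
  tree_abs (mktree (node_step T) (node_sign T) n m k) x = tree_abs (subtree T m k) x.
Proof.
elim: n m k x => [|n IH] m k x; first by case: (subtree _ _ _).
move=> D; rewrite /= !IH ?subtree_left ?subtree_right ?depth_child// /node_step.
by case: (subtree T m k) => //=; rewrite subr0 addr0; field.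
Qed.

Lemma tree_nonneg_subtree (R : realType) (T : tree R) (n m k : nat) (y : R) :
  (depth (subtree T m k) <= n)%N ->
  tree_nonneg (mktree (node_step T) (node_sign T) n m k) y = tree_nonneg (subtree T m k) y.
Proof.
elim: n m k y => [|n IH] m k y; first by case: (subtree _ _ _).
move=> D; rewrite /= !IH ?subtree_left ?subtree_right ?depth_child// /node_step /node_sign.
by case: (subtree T m k) => //=; rewrite mulr0 subr0 addr0; field.
Qed.

Lemma step_on_comp (R : realType) (N : nat) (f : R -> R) (G : nat -> R) (g : R -> R) :
  step_on N f G -> step_on N (fun t => g (f t)) (fun j => g (G j)).
Proof. by move=> Hf j t jN ct; rewrite (Hf j t jN ct). Qed.

(** Intervals outside the finite index set receive coefficient 0 and an
    arbitrary sign of E, which makes every level below N complete. *)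
Lemma tree_of_admissible (R : realType) (E : set R) (x1 x2 x3 : R)
    (phi psi : R -> R) :
  E !=set0 -> admissible E x1 x2 x3 phi psi ->
  tree_values E x1 x2 x3 (nonneg_frac psi).
Proof.
move=> [e0 Ee0] [F [eps [Eeps Hphi Hpsi Hx3]]].
pose N := (\max_(J <- F) tag J).+1.
have FN J : J \in F -> (tag J < N)%N by move=> JF; rewrite ltnS leq_bigmax_seq.
pose c J := if J \in F then haar_coef phi J else 0.
pose e' J := if J \in F then eps J else e0.
pose d n k := if insub k is Some i then c (dyad i) / Num.sqrt (dlen R (@dyad n i)) else 0.
pose e n k := if insub k is Some i then e' (@dyad n i) else e0.
have Hd J : c J / Num.sqrt (dlen R J) = d (tag J) (tagged J).
  by case: J => n i; rewrite /d /= valK.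
have Hed J : e' J * c J / Num.sqrt (dlen R J)
    = (fun n k => e n k * d n k) (tag J) (tagged J).
  by rewrite /= -Hd mulrA; case: J => n i; rewrite /e /= valK.
have phiN : step_on N phi (mart d x1 N).
  apply: (step_on_haar_sum Hd) => t /Hphi ->; congr (_ + _).
  rewrite (big_dyadics _ FN) big_mkcond /=; apply: eq_bigr => J _.
  by rewrite /c; case: ifP; rewrite ?mul0r.
have psiN : step_on N psi (mart (fun n k => e n k * d n k) x2 N).
  apply: (step_on_haar_sum Hed) => t /Hpsi ->; congr (_ + _).
  rewrite (big_dyadics _ FN) big_mkcond /=; apply: eq_bigr => J _.
  by rewrite /c /e'; case: ifP; rewrite ?(mulr0, mul0r).
exists (mktree d e N 0 0); split.
- apply: signs_mktree => n k; rewrite /e /e'; case: insub => // i.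
  by case: ifP => // /Eeps.
- have := tree_abs_mktree d e x1 N 0 0; rewrite /= => ->.
  by rewrite -Hx3 (mean_step (step_on_comp Num.norm phiN)).
- have := tree_nonneg_mktree d e x2 N 0 0; rewrite /= => ->.
  by rewrite (nonneg_frac_step psiN).
Qed.

(** A step d at the node of J is realised by the coefficient d |J|^(1/2); by
    [haar_coef_step] these are the Haar coefficients of the resulting sum. *)
Lemma admissible_of_tree (R : realType) (E : set R) (x1 x2 x3 v : R) :
  E 1 -> tree_values E x1 x2 x3 v ->
  exists phi psi, admissible E x1 x2 x3 phi psi /\ v = nonneg_frac psi.
Proof.
move=> E1 [T [sT tT <-]].
pose d := node_step T; pose e := node_sign T.
pose N := depth T.
pose F := [fset J in dyadics_below N]%fset.
have FE J : (J \in F) = (J \in dyadics_below N) by rewrite inE.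
have FN J : J \in F -> (tag J < N)%N by rewrite FE mem_dyadics_below.
have sumF (g : dyadic -> R) : \sum_(J <- F) g J = \sum_(J <- dyadics_below N) g J.
  rewrite (big_dyadics _ FN) big_seq_cond [RHS]big_seq.
  by apply: eq_bigl => J; rewrite FE andbb.
pose c (J : dyadic) := d (tag J) (tagged J) * Num.sqrt (dlen R J).
pose e' (J : dyadic) := e (tag J) (tagged J).
have s0 J : Num.sqrt (dlen R J) != 0 by rewrite gt_eqF// sqrtr_gt0 dlen_gt0.
have Hd J : c J / Num.sqrt (dlen R J) = d (tag J) (tagged J) by rewrite /c mulfK.
have Hed J : e' J * c J / Num.sqrt (dlen R J)
    = (fun n k => e n k * d n k) (tag J) (tagged J).
  by rewrite -mulrA Hd.
pose phi t := x1 + \sum_(J <- dyadics_below N) c J * haar J t.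
pose psi t := x2 + \sum_(J <- dyadics_below N) e' J * c J * haar J t.
have phiN : step_on N phi (mart d x1 N) by apply: (step_on_haar_sum Hd).
have psiN : step_on N psi (mart (fun n k => e n k * d n k) x2 N).
  exact: (step_on_haar_sum Hed).
have coef J : J \in F -> haar_coef phi J = c J.
  by move=> /FN JN; rewrite (haar_coef_step phiN JN).
exists phi, psi; split.
  exists F, e'; split.
  - move=> J _; rewrite /e' /e /node_sign; move: (signs_subtree (tag J) (tagged J) sT).
    by case: (subtree _ _ _) => //= ? ? ? ? [].
  - by move=> t _; rewrite /phi -sumF; congr (_ + _); apply: eq_big_seq => J /coef ->.
  - by move=> t _; rewrite /psi -sumF; congr (_ + _); apply: eq_big_seq => J /coef ->.
  - rewrite (mean_step (step_on_comp Num.norm phiN)) -tT.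
    have := tree_abs_mktree d e x1 N 0 0; rewrite /= => <-.
    exact: (@tree_abs_subtree R T N 0 0).
rewrite (nonneg_frac_step psiN).
have := tree_nonneg_mktree d e x2 N 0 0; rewrite /= => <-.
by apply/esym; exact: (@tree_nonneg_subtree R T N 0 0).
Qed.

Lemma ereal_sup_admissible (R : realType) (E : set R) (x y z : R) :
  E 1 -> E (-1) -> (forall e, E e -> `|e| <= 1) -> `|x| <= z ->
  ereal_sup [set v | exists phi psi : R -> R,
    admissible E x y z phi psi /\ v = (nonneg_frac psi)%:E] = (bellman x y z)%:E.
Proof.
move=> E1 EN1 Ele hx; have E0 : E !=set0 by exists 1.
have -> : [set v | exists phi psi : R -> R,
    admissible E x y z phi psi /\ v = (nonneg_frac psi)%:E]
    = EFin @` tree_values E x y z.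
  apply/seteqP; split => [_ [phi [psi [h ->]]]|_ [v hv <-]].
    by exists (nonneg_frac psi) => //; exact: tree_of_admissible h.
  have [phi [psi [h ->]]] := admissible_of_tree E1 hv.
  by exists phi, psi.
have [n0 ub] := has_sup_tree_values y E0 hx.
by rewrite ereal_sup_EFin// sup_tree_values.
Qed.

Theorem theorem2p4 (R : realType) (B : R -> R -> R -> \bar R)
    (hB : B = @B_pm R \/ B = @B_eps R) (x1 x2 x3 : R) (hx : `|x1| <= x3) :
  B x1 x2 x3 =
    (if 0 <= x3 + x2 then 1
     else 1 - (x3 + x2) ^+ 2 / (x2 ^+ 2 - x1 ^+ 2))%:E.
Proof.
case: hB => ->; apply: ereal_sup_admissible => //=; rewrite ?normrN ?normr1//.
- by left.
- by right.
- by move=> e [->|->]; rewrite ?normrN normr1.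
Qed.
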